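(* Let $\gamma\in(0,1]$. With the notation of the context: (1) For any CDF $H$ of a compactly supported probability measure on $[0,\infty)$ with $\mathcal{Z}_+(H)>0$, the function $y\mapsto\Psi_\gamma(y;H)$ on $(\mathcal{Z}_+(H),\infty)$ is negative and strictly increasing, with $\lim_{y\to\infty}\Psi_\gamma(y;H)=-2$. (2) Assume moreover that $\lim_{y\downarrow\mathcal{Z}_+(H)}\int(y-z)^{-2}dH(z)=\infty$. Then $T_\gamma(H)$ is the unique number $>\mathcal{Z}_+(H)$ satisfying $\Psi_\gamma(T_\gamma(H);H)=-4$. (3) Let $F_Z$ be a CDF of a compactly supported probability measure on $[0,\infty)$ with $z_+=\mathcal{Z}_+(F_Z)>0$ and $\lim_{y\downarrow z_+}\int(y-z)^{-2}dF_Z(z)=\infty$, and put $\theta^*=T_\gamma(F_Z)$. Then for every signal $\mathbf{x}$, $$\mathrm{ASE}[\mathbf{x}|\theta^*]=\min_{\theta}\mathrm{ASE}[\mathbf{x}|\theta]=\mathrm{ASE}^*[\mathbf{x}],$$ the minimum being over $\theta>0$. Moreover, $\theta^*$ is the unique threshold for which this holds for all signals $\mathbf{x}$.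
   Context: For a CDF $H$ of a compactly supported probability measure on $[0,\infty)$ let $\mathcal{Z}_+(H)=\sup\{z:H(z)<1\}$. For $y>\mathcal{Z}_+(H)$ let $\varphi(y;H)=\int\frac{y}{y^2-z^2}dH(z)$, $\tilde\varphi_\gamma(y;H)=\gamma\varphi(y;H)+\frac{1-\gamma}{y}$, $\mathcal{D}_\gamma(y;H)=\varphi(y;H)\tilde\varphi_\gamma(y;H)$, with primes denoting $y$-derivatives. Define $$\Psi_\gamma(y;H)=y\,\frac{\mathcal{D}_\gamma'(y;H)}{\mathcal{D}_\gamma(y;H)}=y\left(\frac{\varphi'(y;H)}{\varphi(y;H)}+\frac{\tilde\varphi_\gamma'(y;H)}{\tilde\varphi_\gamma(y;H)}\right),\qquad T_\gamma(H)=\inf\{y:\ y>\mathcal{Z}_+(H)\text{ and }\Psi_\gamma(y;H)\ge-4\}.$$ For part (3): write $\mathcal{D}_\gamma(y)=\mathcal{D}_\gamma(y;F_Z)$, which is positive and strictly decreasing to $0$ on $(z_+,\infty)$. Let $x_+=\lim_{y\downarrow z_+}\mathcal{D}_\gamma(y)^{-1/2}\ge0$. For $x>x_+$ let $\mathcal{Y}(x)=\mathcal{D}_\gamma^{-1}(1/x^2)\in(z_+,\infty)$ and $\mathcal{C}(x)=-\frac{2}{x^3}\cdot\frac1{\mathcal{D}_\gamma'(\mathcal{Y}(x))}$. A signal is a vector $\mathbf{x}=(x_1,\dots,x_r)$ with $x_1>\dots>x_r>0$, where $r\ge1$ is fixed. Put $y_{i,\infty}=\mathcal{Y}(x_i)$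 if $x_i>x_+$ and $y_{i,\infty}=z_+$ if $x_i\le x_+$. Let $R_0(x)=x^2$; $R_1(x)=x^2+\mathcal{Y}(x)^2-2x\mathcal{Y}(x)\mathcal{C}(x)$ if $x>x_+$, and $R_1(x)=x^2+z_+^2$ if $x\le x_+$. Then $$\mathrm{ASE}[\mathbf{x}|\theta]=\sum_{i=1}^r\big(\mathbf{1}\{y_{i,\infty}\le\theta\}R_0(x_i)+\mathbf{1}\{y_{i,\infty}>\theta\}R_1(x_i)\big)\ (\theta>0),\qquad \mathrm{ASE}^*[\mathbf{x}]=\sum_{i=1}^r\min\{R_0(x_i),R_1(x_i)\}.$$ *)

(* Defs.v *)
From HB Require Import structures.
From mathcomp Require Import all_boot all_order all_algebra.
From mathcomp Require Import all_classical all_reals all_analysis.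

Set Implicit Arguments.
Unset Strict Implicit.
Unset Printing Implicit Defensive.

Import Order.TTheory GRing.Theory Num.Theory.
Import numFieldNormedType.Exports.

Local Open Scope classical_set_scope.
Local Open Scope ring_scope.

(* A CDF of a probability measure on R is a [cumulativeBounded 0 1], i.e., a
   nondecreasing right-continuous function with limits 0 at -oo and 1 at +oo.
   The measure it determines is [lebesgue_stieltjes_measure H], and integrals
   against dH are [Rintegral]s for that measure. *)

Section Functionals.
Context {R : realType}.
Implicit Types (H : cumulativeBounded (0 : R) (1 : R)) (gamma x y : R).

Definition compactly_supported_on_nonneg H : Prop :=
  exists K : set R, [/\ compact K, K `<=` `[0, +oo[ &
    lebesgue_stieltjes_measure H K = 1%E].

Definition zplus H : R := sup [set z | H z < 1].

(* The functions phi, phit, calD, Psi are meaningful for y > zplus H. Then the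
   zeros of the denominators below (where the total inverse returns 0) form a
   dH-null set, since dH is carried by [0, zplus H]. *)
Definition phi H y : R :=
  \int[lebesgue_stieltjes_measure H]_z (y / (y ^+ 2 - z ^+ 2)).

Definition phit gamma H y : R := gamma * phi H y + (1 - gamma) / y.

Definition calD gamma H y : R := phi H y * phit gamma H y.

Definition Psi gamma H y : R :=
  y * (derive1 (calD gamma H) y / calD gamma H y).

Definition Tgamma gamma H : R :=
  inf [set y | zplus H < y /\ -4 <= Psi gamma H y].

Definition edge_blowup H : Prop :=
  (fun y : R => \int[lebesgue_stieltjes_measure H]_z ((y - z) ^- 2))
    @ (zplus H)^'+ --> +oo.

Definition xplus gamma H : R :=
  lim ((fun y => calD gamma H y `^ (- 2^-1)) @ (zplus H)^'+).

(* calY inverts calD restricted to ]zplus H, +oo[; it is used for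
   x > xplus gamma H only, when 1 / x ^+ 2 is in the range. *)
Definition calY gamma H x : R :=
  'pinv_(fun=> 0) `]zplus H, +oo[ (calD gamma H) (1 / x ^+ 2).

Definition calC gamma H x : R :=
  - (2 / x ^+ 3) * (1 / derive1 (calD gamma H) (calY gamma H x)).

Definition yinf gamma H x : R :=
  if xplus gamma H < x then calY gamma H x else zplus H.

Definition R0 x : R := x ^+ 2.

Definition R1 gamma H x : R :=
  if xplus gamma H < x
  then x ^+ 2 + calY gamma H x ^+ 2 - 2 * x * calY gamma H x * calC gamma H x
  else x ^+ 2 + zplus H ^+ 2.

Definition signal (r : nat) (x : 'rV[R]_r) : Prop :=
  (forall i j : 'I_r, (i < j)%N -> x 0 j < x 0 i) /\
  (forall i : 'I_r, 0 < x 0 i).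

Definition ASE gamma H (r : nat) (x : 'rV[R]_r) (theta : R) : R :=
  \sum_(i < r) ((yinf gamma H (x 0 i) <= theta)%R%:R * R0 (x 0 i)
              + (theta < yinf gamma H (x 0 i))%R%:R * R1 gamma H (x 0 i)).

Definition ASEstar gamma H (r : nat) (x : 'rV[R]_r) : R :=
  \sum_(i < r) Num.min (R0 (x 0 i)) (R1 gamma H (x 0 i)).

Definition is_minimum (S : set R) (m : R) : Prop := S m /\ lbound S m.

Definition optimal_threshold gamma H (r : nat) (x : 'rV[R]_r) (theta : R) :
    Prop :=
  is_minimum [set ASE gamma H x t | t in `]0, +oo[] (ASE gamma H x theta) /\
  ASE gamma H x theta = ASEstar gamma H x.

End Functionals.

(* Main.v *)
Require Import Defs.
From HB Require Import structures.
From mathcomp Require Import all_boot all_order all_algebra.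
From mathcomp Require Import all_classical all_reals all_analysis.
From mathcomp Require Import measurable_realfun ring lra.

Set Implicit Arguments.
Unset Strict Implicit.
Unset Printing Implicit Defensive.

Import Order.TTheory GRing.Theory Num.Theory.
Import numFieldNormedType.Exports.

Local Open Scope classical_set_scope.
Local Open Scope ring_scope.

(** Everything becomes transparent in the variable [s = y ^+ 2]. Put
    [w = z ^+ 2] and let [A k s] be the integral of [(s - w) ^- k], so that
    [phi y = y * A 1 (y ^+ 2)] and [A 1] has derivative [- A 2]. The function
    [phit] has the same form for the mixture of [dH], with weight [gamma], and
    of the unit mass at 0, with weight [1 - gamma]. Hence
    [[
      Psi y = 2 - 2 * L s - 2 * L' s,      L s = s * A 2 s / A 1 s,
    ]]
    where [L'] is [L] for the mixture: [- L] is the logarithmic derivative of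
    [A 1] with respect to [ln s].

    Monotonicity of [L] rests on [A 1 s = s * A 2 s - W s], where [W s] is the
    integral of [w * (s - w) ^- 2]. Thus [L s = s / (s - m s)], where
    [m s = W s / A 2 s] is the mean of [w] under the weight [(s - w) ^- 2]. As
    [s] grows, this weight favours the large values of [w] less and less, so
    [m] is nonincreasing (weighted_mean_nonincreasing), and [L] is strictly
    decreasing as soon as [w] is not almost everywhere 0. Since [w] lies
    between 0 and [zplus ^+ 2], we get [1 <= L s <= s / (s - zplus ^+ 2)], which
    gives the sign of [Psi] and its limit.

    At the edge, the inequality of arithmetic and geometric means shows that
    [L s] is large when [s ^+ 2 * A 2 s] is, because [dH] has mass 1
    (elasticity_ge); the blow-up hypothesis therefore brings [Psi] below -4
    near [zplus]. The intermediate value theorem and monotonicity then single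
    out [Tgamma] as the root of [Psi y = -4].

    For the thresholds, parametrize a signal strength [x > xplus] by
    [y = calY x], so that [calD y = 1 / x ^+ 2]. By the definition of [calC],
    [[
      R1 x - R0 x = (Psi y + 4) * (y ^+ 2 / Psi y)
    ]]
    (R1_sub_R0). As [Psi < 0], this is nonnegative exactly when
    [Psi y <= -4], that is when [y <= Tgamma]: thresholding at [Tgamma] makes
    the better choice in each coordinate. At any other threshold, every signal
    whose values [y] fall between the threshold and [Tgamma] incurs a strictly
    larger error, and such signals exist with any number of coordinates. *)

(** * Measurability and integration on a finite measure *)

Lemma measurable_invr (R : realType) : measurable_fun setT (fun x : R => x^-1).
Proof.
rewrite -(setUv [set 0 : R]); apply/measurable_funU => //.
  by apply: measurableC.
split; first exact: measurable_fun_set1.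
apply: open_continuous_measurable_fun.
  by apply: closed_openC; exact: closed_eq.
by move=> x; rewrite inE/= => /eqP x0; exact: inv_continuous.
Qed.

Lemma bounded_integrable d (T : measurableType d) (R : realType)
    (mu : {measure set T -> \bar R}) (f : T -> R) (M : R) :
  (mu setT < +oo)%E -> measurable_fun setT f -> (forall x, `|f x| <= M) ->
  mu.-integrable setT (EFin \o f).
Proof.
move=> fmu mf fM; apply: measurable_bounded_integrable => //.
exists M; split; first by rewrite num_real.
by move=> N MN x _ /=; rewrite (le_trans (fM x))// ltW.
Qed.

Lemma Rintegral_gt0 d (T : measurableType d) (R : realType)
    (mu : {measure set T -> \bar R}) (f : T -> R) :
  mu.-integrable setT (EFin \o f) -> (forall x, 0 <= f x) ->
  (0 < mu [set x | (f x != 0)%R])%E -> 0 < \int[mu]_x f x.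
Proof.
move=> fi f0 muf; rewrite lt_neqAle Rintegral_ge0// andbT eq_sym.
apply/eqP => If0.
have mf := measurable_int mu fi.
have : (\int[mu]_x `|(f x)%:E|)%E = 0%E.
  under eq_integral do rewrite abse_EFin ger0_norm//.
  rewrite -[LHS]fineK ?integrable_fin_num//.
  by rewrite -/(Rintegral mu setT f) If0.
move=> /(ae_eq_integral_abs mu measurableT mf) [N [mN N0 fN]].
suff : (mu [set x | f x != 0%R] <= mu N)%E by rewrite N0 leNgt muf.
apply: le_measure; rewrite ?inE//; last first.
  by move=> x /= fx; apply: fN => /= /(_ I) [] /eqP; rewrite (negbTE fx).
have -> : [set x | f x != 0%R] = setT `&` f @^-1` (~` [set 0]).
  by rewrite setTI; apply/seteqP; split => x /= /eqP.
by move/measurable_EFinP : mf; apply => //; exact: measurableC.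
Qed.

(** * Moments of the resolvent of a bounded function *)

Lemma is_derive_resolvent (R : realType) k (a t : R) : t - a != 0 ->
  is_derive t 1 (fun t => (t - a)^-1 ^+ k) (- (k%:R * (t - a)^-1 ^+ k.+1)).
Proof.
move=> ta.
have h : is_derive t 1 (fun t => t - a) 1.
  by apply: is_derive_eq; rewrite oppr0 addr0.
have hX := is_deriveX k (@is_deriveV _ (fun t => t - a) _ _ _ ta h).
rewrite [X in is_derive _ _ _ X](_ : _ =
  (k%:R * (t - a)^-1 ^+ k.-1) *: (- (t - a) ^- 2 *: 1)).
  by move: hX; rewrite exprfctE.
rewrite /GRing.scale /= mulr1; case: k {hX} => [|k].
  by rewrite mulr0n !mul0r oppr0.
by rewrite !exprS; field.
Qed.

Section Resolvent.
Context d (T : measurableType d) (R : realType).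
Variables (mu : {measure set T -> \bar R}) (w : T -> R) (c : R).
Hypothesis fmu : (mu setT < +oo)%E.
Hypothesis mw : measurable_fun setT w.
Hypothesis w_ge0 : forall x, 0 <= w x.
Hypothesis w_le : forall x, w x <= c.

Definition resolvent_moment (k : nat) (s : R) : R :=
  \int[mu]_x (s - w x)^-1 ^+ k.

Let res_gt0 s x : c < s -> 0 < (s - w x)^-1.
Proof. by move=> cs; rewrite invr_gt0 subr_gt0 (le_lt_trans (w_le x)). Qed.

Let res_ge0 s x : c < s -> 0 <= (s - w x)^-1.
Proof. by move=> cs; exact/ltW/res_gt0. Qed.

Let res_le s x : c < s -> (s - w x)^-1 <= (s - c)^-1.
Proof.
move=> cs; rewrite lef_pV2 ?posrE ?subr_gt0 ?(le_lt_trans (w_le x))//.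
by rewrite lerB.
Qed.

Let mres s k : measurable_fun setT (fun x => (s - w x)^-1 ^+ k).
Proof.
apply: (measurableT_comp (exprn_measurable _)).
by apply: (measurableT_comp (@measurable_invr R)); exact: measurable_funB.
Qed.

Lemma resolvent_moment_integrable k s : c < s ->
  mu.-integrable setT (fun x => ((s - w x)^-1 ^+ k)%:E).
Proof.
move=> cs; apply: (@bounded_integrable _ _ _ _ _ ((s - c)^-1 ^+ k)) => // x.
rewrite ger0_norm ?exprn_ge0 ?res_ge0//.
by rewrite lerXn2r ?nnegrE ?res_ge0 ?invr_ge0 ?subr_ge0 ?(ltW cs)// res_le.
Qed.

Lemma scaled_resolvent_moment_integrable a k s : c < s ->
  mu.-integrable setT (fun x => (a * (s - w x)^-1 ^+ k)%:E).
Proof.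
move=> cs; under eq_fun do rewrite EFinM.
by apply: integrableZl => //; exact: resolvent_moment_integrable.
Qed.

(** Differentiation under the integral sign: on [t > u], with [u] halfway
    between [c] and [s], the derivative of the integrand is bounded by the
    constant obtained by putting [u - c] in place of [t - w]. *)
Lemma is_derive_resolvent_moment k s : c < s ->
  is_derive s 1 (resolvent_moment k) (- (k%:R * resolvent_moment k.+1 s)).
Proof.
move=> cs; set u := (c + s) / 2.
have cu : c < u by rewrite midf_lt.
have us : u < s by rewrite midf_lt.
pose f s x := (s - w x)^-1 ^+ k.
have df t x : c < t -> is_derive t 1 (f ^~ x) (- (k%:R * (t - w x)^-1 ^+ k.+1)).
  move=> ct; apply: is_derive_resolvent.
  by rewrite gt_eqF// subr_gt0 (le_lt_trans (w_le x)).
pose G := k%:R * (u - c)^-1 ^+ k.+1.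
have I_s : `]u, s + 1[%classic s by rewrite /= in_itv/= us ltrDl ltr01.
have int_f t : `]u, s + 1[%classic t -> mu.-integrable setT (EFin \o f t).
  rewrite /= in_itv/= => /andP[ut _]; apply: resolvent_moment_integrable.
  exact: lt_trans ut.
have der_f t x : `]u, s + 1[%classic t -> setT x -> derivable (f ^~ x) t 1.
  by rewrite /= in_itv/= => /andP[ut _] _; case: (df t x (lt_trans cu ut)).
have G0 (x : T) : 0 <= G.
  by rewrite mulr_ge0// exprn_ge0// invr_ge0 subr_ge0 ltW.
have int_G : mu.-integrable setT (EFin \o cst G).
  by apply: (@bounded_integrable _ _ _ _ _ G) => // x; rewrite ger0_norm ?G0.
have G_ub t x : `]u, s + 1[%classic t -> setT x -> `|partial1of2 f t x| <= G.
  rewrite /= in_itv/= => /andP[ut _] _.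
  have ct := lt_trans cu ut.
  rewrite partial1of2E (@derive_val _ _ _ _ _ _ _ (df t x ct)) normrN normrM.
  rewrite ger0_norm// ler_wpM2l// ger0_norm ?exprn_ge0 ?res_ge0//.
  rewrite lerXn2r ?nnegrE ?res_ge0 ?invr_ge0 ?subr_ge0 ?(ltW cu)//.
  rewrite lef_pV2 ?posrE ?subr_gt0 ?(le_lt_trans (w_le x))//.
  by rewrite lerB// ltW.
apply: DeriveDef.
  exact: (derivable_under_integral measurableT I_s int_f der_f G0 int_G G_ub).
rewrite -derive1E.
rewrite (differentiation_under_integral
  measurableT I_s int_f der_f G0 int_G G_ub).
rewrite /resolvent_moment -mulNr -RintegralZl//; last first.
  exact: resolvent_moment_integrable.
apply: eq_Rintegral => x _.
by rewrite partial1of2E (@derive_val _ _ _ _ _ _ _ (df s x cs)) mulNr.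
Qed.

Hypothesis c_ge0 : 0 <= c.
Hypothesis w_neq0 : (0 < mu [set x | (w x != 0)%R])%E.

Let mu_gt0 : (0 < mu setT)%E.
Proof.
apply: (lt_le_trans w_neq0); apply: le_measure; rewrite ?inE//.
have -> : [set x | w x != 0%R] = setT `&` w @^-1` (~` [set 0]).
  by rewrite setTI; apply/seteqP; split => x /= /eqP.
by apply: mw => //; exact: measurableC.
Qed.

Lemma resolvent_moment_gt0 k s : c < s -> 0 < resolvent_moment k s.
Proof.
move=> cs; apply: Rintegral_gt0; first exact: resolvent_moment_integrable.
  by move=> x; rewrite exprn_ge0// res_ge0.
rewrite [X in mu X](_ : _ = setT)//; apply/seteqP; split => x //= _.
by rewrite expf_neq0// gt_eqF// res_gt0.
Qed.

Lemma resolvent_moment1_le s : c < s ->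
  resolvent_moment 1 s <= fine (mu setT) / (s - c).
Proof.
move=> cs; rewrite mulrC -Rintegral_cst//.
apply: le_Rintegral => //; first exact: resolvent_moment_integrable.
  apply: (@bounded_integrable _ _ _ _ _ `|(s - c)^-1|) => //.
by move=> x _; rewrite expr1 res_le.
Qed.

Definition weighted_moment (s : R) : R := \int[mu]_x (w x * (s - w x)^-1 ^+ 2).

Let weighted_moment_integrable s : c < s ->
  mu.-integrable setT (fun x => (w x * (s - w x)^-1 ^+ 2)%:E).
Proof.
move=> cs; apply: (@bounded_integrable _ _ _ _ _ (c * (s - c)^-1 ^+ 2)) => //.
  exact: measurable_funM.
move=> x; rewrite ger0_norm ?mulr_ge0 ?exprn_ge0 ?res_ge0//.
rewrite ler_pM ?exprn_ge0 ?res_ge0//.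
by rewrite lerXn2r ?nnegrE ?res_ge0 ?invr_ge0 ?subr_ge0 ?(ltW cs)// res_le.
Qed.

Lemma weighted_moment_gt0 s : c < s -> 0 < weighted_moment s.
Proof.
move=> cs; apply: Rintegral_gt0; first exact: weighted_moment_integrable.
  by move=> x; rewrite mulr_ge0 ?exprn_ge0 ?res_ge0.
rewrite [X in mu X](_ : _ = [set x | w x != 0])//.
apply/seteqP; split => x /=; first by apply: contra => /eqP ->; rewrite mul0r.
by move=> wx; rewrite mulf_neq0// expf_neq0// gt_eqF// res_gt0.
Qed.

Lemma weighted_moment_le s : c < s ->
  weighted_moment s <= c * resolvent_moment 2 s.
Proof.
move=> cs; rewrite /resolvent_moment -RintegralZl//; last first.
  exact: resolvent_moment_integrable.
apply: le_Rintegral => //; first exact: weighted_moment_integrable.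
  exact: scaled_resolvent_moment_integrable.
by move=> x _; rewrite ler_wpM2r// exprn_ge0// res_ge0.
Qed.

(** Integrated form of [(s - w)^-1 = s * (s - w) ^- 2 - w * (s - w) ^- 2]. *)
Lemma resolvent_moment1E s : c < s ->
  resolvent_moment 1 s = s * resolvent_moment 2 s - weighted_moment s.
Proof.
move=> cs; rewrite /resolvent_moment -RintegralZl//; last first.
  exact: resolvent_moment_integrable.
rewrite -RintegralB//; last 2 first.
- exact: scaled_resolvent_moment_integrable.
- exact: weighted_moment_integrable.
apply: eq_Rintegral => x _.
have sx : s - w x != 0 by rewrite gt_eqF// subr_gt0 (le_lt_trans (w_le x)).
by rewrite expr1; field.
Qed.

(** The mean of [w] under the weight [(s - w) ^- 2] does not increase with [s].
    Chebyshev's argument in a single variable: with [w0] the mean at [s2], the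
    ratio of the weights at [s1] and at [s2] increases with [w] and equals
    [rho] at [w0]. Replacing the weight at [s1] by [rho] times the weight at
    [s2] therefore lowers the product of the weight with [w - w0] pointwise,
    and leaves the integral 0, so that [w0] is at most the mean at [s1]. *)
Lemma weighted_mean_nonincreasing s1 s2 : c < s1 -> s1 < s2 ->
  weighted_moment s2 * resolvent_moment 2 s1 <=
  weighted_moment s1 * resolvent_moment 2 s2.
Proof.
move=> cs1 s12; have cs2 := lt_trans cs1 s12.
have B2 := resolvent_moment_gt0 2 cs2.
set w0 := weighted_moment s2 / resolvent_moment 2 s2.
have w0c : w0 <= c by rewrite ler_pdivrMr// weighted_moment_le.
have W2E : weighted_moment s2 = w0 * resolvent_moment 2 s2.
  by rewrite divfK// gt_eqF.
clearbody w0.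
pose g s x := w x * (s - w x)^-1 ^+ 2 - w0 * (s - w x)^-1 ^+ 2.
have ig s : c < s -> mu.-integrable setT (EFin \o g s).
  move=> cs; rewrite /g /comp; under eq_fun do rewrite EFinB.
  apply: integrableB => //; first exact: weighted_moment_integrable.
  exact: scaled_resolvent_moment_integrable.
have gE s : c < s ->
    \int[mu]_x g s x = weighted_moment s - w0 * resolvent_moment 2 s.
  move=> cs; rewrite RintegralB//; last 2 first.
  - exact: weighted_moment_integrable.
  - exact: scaled_resolvent_moment_integrable.
  by rewrite RintegralZl//; exact: resolvent_moment_integrable.
set rho := ((s2 - w0) / (s1 - w0)) ^+ 2.
have : rho * \int[mu]_x g s2 x <= \int[mu]_x g s1 x.
  rewrite -RintegralZl//; last exact: ig.
  apply: le_Rintegral => //; [|exact: ig|].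
    rewrite (_ : _ \o _ = (fun x => rho%:E * (g s2 x)%:E)%E)//.
    by apply: integrableZl => //; exact: ig.
  move=> x _; have wx := w_le x.
  have a1 : 0 < s1 - w0 by lra.
  have a2 : 0 < s2 - w0 by lra.
  have b1 : 0 < s1 - w x by lra.
  have b2 : 0 < s2 - w x by lra.
  rewrite -subr_ge0.
  suff -> : g s1 x - rho * g s2 x = (w x - w0) ^+ 2 * (s2 - s1) *
      (((s1 - w x)^-1 + (s2 - w0) / (s1 - w0) * (s2 - w x)^-1) *
       ((s1 - w0)^-1 * (s1 - w x)^-1 * (s2 - w x)^-1)).
    have s21 : 0 < s2 - s1 by rewrite subr_gt0.
    rewrite mulr_ge0//; first by rewrite mulr_ge0 ?sqr_ge0// ltW.
    apply/ltW/mulr_gt0; last by rewrite !mulr_gt0 ?invr_gt0.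
    by rewrite addr_gt0 ?invr_gt0// mulr_gt0 ?divr_gt0 ?invr_gt0.
  by rewrite /g /rho; field; rewrite !gt_eqF.
rewrite !gE// W2E subrr mulr0 subr_ge0 => h.
by rewrite mulrAC ler_wpM2r// ltW.
Qed.

(** The elasticity [- s * f' s / f s] of the resolvent moment [f] of order 1. *)
Definition elasticity s := s * resolvent_moment 2 s / resolvent_moment 1 s.

(** The elasticity is [s / (s - m s)] with [m] the weighted mean of [w], and
    [m s / s] is strictly decreasing: [m] is positive and nonincreasing. *)
Lemma elasticity_decreasing s1 s2 : c < s1 -> s1 < s2 ->
  elasticity s2 < elasticity s1.
Proof.
move=> cs1 s12; have cs2 := lt_trans cs1 s12.
rewrite /elasticity ltr_pdivrMr ?resolvent_moment_gt0// mulrAC.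
rewrite ltr_pdivlMr ?resolvent_moment_gt0//.
rewrite !resolvent_moment1E//.
have := weighted_mean_nonincreasing cs1 s12.
have := resolvent_moment_gt0 2 cs2; have := weighted_moment_gt0 cs1.
move: (weighted_moment s1) (weighted_moment s2) => W1 W2.
move: (resolvent_moment 2 s1) (resolvent_moment 2 s2) => B1 B2 hW1 hB2 h.
suff : s1 * (W2 * B1) < s2 * (W1 * B2) by lra.
have s1_gt0 := le_lt_trans c_ge0 cs1.
apply: (@le_lt_trans _ _ (s1 * (W1 * B2))); first by rewrite ler_pM2l.
by rewrite ltr_pM2r// mulr_gt0.
Qed.

Lemma elasticity_ge1 s : c < s -> 1 <= elasticity s.
Proof.
move=> cs; rewrite /elasticity ler_pdivlMr ?resolvent_moment_gt0// mul1r.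
rewrite resolvent_moment1E//.
by have := weighted_moment_gt0 cs; lra.
Qed.

Lemma elasticity_le s : c < s -> elasticity s <= s / (s - c).
Proof.
move=> cs; have s_gt0 := le_lt_trans c_ge0 cs.
rewrite /elasticity ler_pdivrMr ?resolvent_moment_gt0// mulrAC.
rewrite ler_pdivlMr ?subr_gt0//.
rewrite -mulrA ler_pM2l// resolvent_moment1E//.
by have := weighted_moment_le cs; lra.
Qed.

Lemma elasticity_cvg : elasticity s @[s --> +oo] --> (1 : R).
Proof.
apply/cvgrPdist_lt => e e0; near=> s.
have cs : c < s by near: s; apply: nbhs_pinfty_gt; rewrite num_real.
have ces : c + c / e < s by near: s; apply: nbhs_pinfty_gt; rewrite num_real.
have sc : 0 < s - c by rewrite subr_gt0.
rewrite distrC ger0_norm; last by rewrite subr_ge0 elasticity_ge1.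
rewrite ltrBlDr (le_lt_trans (elasticity_le cs))// ltr_pdivrMr//.
suff : c < e * (s - c) by lra.
by rewrite mulrC -ltr_pdivrMr// ltrBrDl.
Unshelve. all: by end_near. Qed.

Lemma resolvent_moment_continuous k s : c < s ->
  {for s, continuous (resolvent_moment k)}.
Proof.
move=> cs; have [dA _] := is_derive_resolvent_moment k cs.
by apply: differentiable_continuous; apply/derivable1_diffP.
Qed.

Lemma elasticity_continuous s : c < s -> {for s, continuous elasticity}.
Proof.
move=> cs; apply: cvgM; last apply: cvgV.
- by apply: cvgM; [exact: cvg_id|exact: resolvent_moment_continuous].
- by rewrite gt_eqF// resolvent_moment_gt0.
- exact: resolvent_moment_continuous.
Qed.

(** For a probability measure, integrating [2 * K * q <= q ^+ 2 + K ^+ 2] with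
    [q = s / (s - w)] bounds the ratio of the integrals of [q ^+ 2] and [q],
    which is the elasticity, from below by [K] once the former integral is at
    least [K ^+ 2]. *)
Lemma elasticity_ge K s : mu setT = 1%E -> c < s -> 0 <= K ->
  K ^+ 2 <= s ^+ 2 * resolvent_moment 2 s -> K <= elasticity s.
Proof.
move=> mu1 cs K0 Ks; have s_gt0 := le_lt_trans c_ge0 cs.
rewrite /elasticity ler_pdivlMr ?resolvent_moment_gt0//.
have iK : mu.-integrable setT (fun x => (K ^+ 2)%:E).
  apply: (@bounded_integrable _ _ _ _ _ (K ^+ 2)) => // x.
  by rewrite ger0_norm// sqr_ge0.
have : 2 * K * s * resolvent_moment 1 s <=
    s ^+ 2 * resolvent_moment 2 s + K ^+ 2.
  have -> : K ^+ 2 = \int[mu]_x (K ^+ 2) by rewrite Rintegral_cst// mu1 mulr1.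
  rewrite -!RintegralZl//; [|exact: resolvent_moment_integrable..].
  rewrite -RintegralD//; last exact: scaled_resolvent_moment_integrable.
  apply: le_Rintegral => //; first exact: scaled_resolvent_moment_integrable.
    rewrite /comp; under eq_fun do rewrite EFinD.
    by apply: integrableD => //; exact: scaled_resolvent_moment_integrable.
  move=> x _; rewrite -subr_ge0 expr1.
  by rewrite (_ : _ - _ = (s * (s - w x)^-1 - K) ^+ 2) ?sqr_ge0//; ring.
have := resolvent_moment_gt0 1 cs.
move: (resolvent_moment 1 s) (resolvent_moment 2 s) Ks => A B Ks A0 h.
suff : s * (K * A) <= s * (s * B) by rewrite ler_pM2l.
have [|] := leP K (s * A); nra.
Qed.

End Resolvent.

(** * The measure of a compactly supported distribution function *)

Section Spectrum.
Context {R : realType}.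
Variable H : cumulativeBounded (0 : R) (1 : R).
Hypothesis suppH : compactly_supported_on_nonneg H.
Hypothesis zplus_gt0 : 0 < zplus H.

Local Notation mu := (lebesgue_stieltjes_measure H).

Lemma dH_itv (a b : R) : a <= b -> mu `]a, b]%classic = (H b - H a)%:E.
Proof.
move=> ab; rewrite /lebesgue_stieltjes_measure.
rewrite /measure_extension measurable_mu_extE/=; last exact: is_ocitv.
by rewrite wlength_itv_bnd.
Qed.

Lemma cdf_bounds (z : R) : 0 <= H z <= 1.
Proof.
by rewrite -!lee_fin -cdf_lebesgue_stieltjes_id cdf_ge0 cdf_le1.
Qed.

Lemma cdf_nneg_support : exists M, H M = 1 /\ forall a, a < 0 -> H a = 0.
Proof.
have [K [cK K0 muK]] := suppH.
have [M [_ KM]] := compact_bounded cK.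
suff h a : a < 0 -> H (`|M| + 1) = 1 /\ H a = 0.
  by exists (`|M| + 1); split=> [|a /h[]//]; have [] := h _ (ltrN10 _).
move=> a0; have aM : a <= `|M| + 1 by rewrite (le_trans (ltW a0))// addr_ge0.
have : (mu K <= mu `]a, (`|M| + 1)%R]%classic)%E.
  apply: le_measure; rewrite ?inE//.
  - exact: compact_measurable.
  - move=> x Kx /=; rewrite in_itv/=.
    have := K0 _ Kx; rewrite /= in_itv/= andbT => x0.
    rewrite (lt_le_trans a0)//= (le_trans (ler_norm _))//.
    by apply: KM => //; rewrite ltr_pwDr// ler_norm.
rewrite muK dH_itv// lee_fin.
have := cdf_bounds a; have := cdf_bounds (`|M| + 1); lra.
Qed.

Lemma cdf_lt1_has_sup : has_sup [set z | H z < 1].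
Proof.
have [M [HM H0]] := cdf_nneg_support; split.
  by exists (-1) => /=; rewrite H0 ?ltrN10.
exists M => z /= Hz; rewrite leNgt; apply/negP => Mz.
have : H M <= H z by apply: cumulative_is_nondecreasing; exact: ltW.
by rewrite HM leNgt Hz.
Qed.

Lemma cdf_lt1 z : z < zplus H -> H z < 1.
Proof.
move=> zz; have [y /= Hy zy] := sup_gt cdf_lt1_has_sup.1 zz.
by rewrite (le_lt_trans _ Hy)// cumulative_is_nondecreasing// ltW.
Qed.

Lemma cdf_gt_zplus z : zplus H < z -> H z = 1.
Proof.
move=> zz; have /andP[_ Hz1] := cdf_bounds z.
apply/eqP; rewrite eq_le Hz1 leNgt; apply/negP => Hz.
by have /(_ z Hz) := ub_le_sup cdf_lt1_has_sup.2; rewrite leNgt zz.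
Qed.

Lemma cdf_zplus : H (zplus H) = 1.
Proof.
have /andP[_ Hz1] := cdf_bounds (zplus H).
apply/eqP; rewrite eq_le Hz1/=; apply/ler_addgt0Pr => e e0.
have [d Hd] := nondecreasing_right_continuousP (zplus H) H e0.
have {}Hd : H (zplus H + d%:num) <= H (zplus H) + e by [].
by rewrite (le_trans _ Hd)// cdf_gt_zplus ?ltrDl.
Qed.

Lemma dH_support : mu (~` `](- zplus H), (zplus H)]%classic) = 0%E.
Proof.
have [_ [_ H0]] := cdf_nneg_support.
have I1 : mu `](- zplus H), (zplus H)]%classic = 1%E.
  rewrite dH_itv ?cdf_zplus; last by rewrite ge0_cp// ltW.
  by rewrite H0 ?oppr_lt0// subr0.
by rewrite [LHS]probability_setC// [X in (1 - X)%E]I1 subee.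
Qed.

(** Integrands are only controlled on the support of [dH]. Projecting the
    variable onto [- zplus, zplus], which changes nothing almost everywhere,
    makes them bounded on the whole line. *)
Definition clip (z : R) : R := Num.max (- zplus H) (Num.min z (zplus H)).

Definition clip_sqr z := clip z ^+ 2.

Lemma measurable_clip : measurable_fun setT clip.
Proof.
by apply: measurable_maxr => //; apply: measurable_minr.
Qed.

Lemma clip_bounds z : - zplus H <= clip z <= zplus H.
Proof.
rewrite /clip le_max lexx/= ge_max ge_min lexx orbT andbT.
by rewrite ge0_cp ?ltW.
Qed.

Lemma clip_id z : - zplus H <= z <= zplus H -> clip z = z.
Proof.
by move=> /andP[h1 h2]; rewrite /clip (min_idPl h2) (max_idPr h1).
Qed.

Lemma Rintegral_clip (f : R -> R) : measurable_fun setT f ->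
  \int[mu]_z f z = \int[mu]_z f (clip z).
Proof.
move=> mf; rewrite /Rintegral; congr fine.
apply: ae_eq_integral => //.
- exact/measurable_EFinP.
- by apply/measurable_EFinP; apply: measurableT_comp mf measurable_clip.
- exists (~` `](- zplus H), (zplus H)]%classic); split.
  + exact: measurableC.
  + exact: dH_support.
  + move=> z /= hz; rewrite in_itv/= => hz'; apply: hz => _.
    by rewrite clip_id//; move: hz' => /andP[/ltW -> ->].
Qed.

Lemma measurable_clip_sqr : measurable_fun setT clip_sqr.
Proof. exact: measurable_funX measurable_clip. Qed.

Lemma clip_sqr_ge0 z : 0 <= clip_sqr z. Proof. exact: sqr_ge0. Qed.

Lemma clip_sqr_le z : clip_sqr z <= zplus H ^+ 2.
Proof. by have := clip_bounds z; rewrite /clip_sqr => /andP[]; nra. Qed.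

Lemma clip_sqr_neq0 : (0 < mu [set z | (clip_sqr z != 0)%R])%E.
Proof.
set z0 := zplus H / 2.
have z0_gt0 : 0 < z0 by rewrite divr_gt0.
have z0_lt : z0 < zplus H by rewrite ltr_pdivrMr// mulr_natr mulr2n ltrDl.
have : (0 < mu `]z0, (zplus H)]%classic)%E.
  rewrite dH_itv ?(ltW z0_lt)// lte_fin [X in X - _]cdf_zplus subr_gt0.
  exact: cdf_lt1.
move=> /lt_le_trans; apply; apply: le_measure; rewrite ?inE//.
  have -> : [set z | clip_sqr z != 0] = setT `&` clip_sqr @^-1` (~` [set 0]).
    by rewrite setTI; apply/seteqP; split => x /= /eqP.
  by apply: measurable_clip_sqr => //; exact: measurableC.
move=> z /=; rewrite in_itv/= => /andP[zz0 zz].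
by rewrite /clip_sqr clip_id ?sqrf_eq0 ?gt_eqF ?(lt_trans z0_gt0)//; lra.
Qed.

(** * The transforms as resolvent moments *)

Let sqr_zplus_lt y : zplus H < y -> zplus H ^+ 2 < y ^+ 2.
Proof.
by move=> zy; rewrite ltr_pXn2r ?nnegrE// ltW// (lt_trans zplus_gt0).
Qed.

Lemma dH_lty : (mu setT < +oo)%E.
Proof. by rewrite (le_lt_trans (probability_le1 mu _))// ltry. Qed.

Lemma phiE y : zplus H < y ->
  phi H y = y * resolvent_moment mu clip_sqr 1 (y ^+ 2).
Proof.
move=> zy; rewrite /phi.
rewrite (@Rintegral_clip (fun z => y / (y ^+ 2 - z ^+ 2))); last first.
  apply: measurable_funM => //; apply: (measurableT_comp (@measurable_invr R)).
  exact: measurable_funB.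
rewrite /resolvent_moment -RintegralZl//.
apply: (resolvent_moment_integrable dH_lty measurable_clip_sqr clip_sqr_le).
exact: sqr_zplus_lt.
Qed.

(** On the support, [(y + z) ^+ 2 <= 4 * y ^+ 2], so the blow-up of the
    left-hand side at the edge forces that of the second moment. *)
Lemma edge_le y : zplus H < y ->
  \int[mu]_z ((y - z) ^- 2) <=
  4 * (y ^+ 2 * resolvent_moment mu clip_sqr 2 (y ^+ 2)).
Proof.
move=> zy; rewrite (@Rintegral_clip (fun z => (y - z) ^- 2)); last first.
  apply: (measurableT_comp (@measurable_invr R)); apply: measurable_funX.
  exact: measurable_funB.
rewrite mulrA -RintegralZl//; last first.
  apply: (resolvent_moment_integrable dH_lty measurable_clip_sqr clip_sqr_le).
  exact: sqr_zplus_lt.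
apply: le_Rintegral => //.
- apply: (@bounded_integrable _ _ _ _ _ ((y - zplus H) ^- 2)).
  + exact: dH_lty.
  + apply: (measurableT_comp (@measurable_invr R)); apply: measurable_funX.
    by apply: measurable_funB => //; exact: measurable_clip.
  + move=> z; have /andP[_ zz] := clip_bounds z.
    have h : 0 < y - clip z by lra.
    have cy : clip z < y by rewrite -subr_gt0.
    rewrite ger0_norm ?invr_ge0 ?sqr_ge0//.
    rewrite lef_pV2 ?posrE ?exprn_gt0 ?subr_gt0//.
    by rewrite lerXn2r ?nnegrE ?(ltW h) ?subr_ge0 ?(ltW zy)// lerB.
- exact: (scaled_resolvent_moment_integrable dH_lty measurable_clip_sqr
    clip_sqr_le (4 * y ^+ 2) 2 (sqr_zplus_lt zy)).
move=> z _; have /andP[z1 z2] := clip_bounds z.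
have h : 0 < y - clip z by lra.
have h' : 0 < y + clip z by lra.
have hsq : y ^+ 2 - clip z ^+ 2 != 0.
  by rewrite subr_sqr mulf_neq0 ?gt_eqF.
rewrite /clip_sqr -subr_ge0.
have -> : 4 * y ^+ 2 * (y ^+ 2 - clip z ^+ 2)^-1 ^+ 2 - (y - clip z) ^- 2 =
   (y - clip z) * (3 * y + clip z) * ((y - clip z) ^- 2 * (y + clip z) ^- 2).
  by field; rewrite hsq !gt_eqF.
have h3 : 0 < 3 * y + clip z by have := zplus_gt0; lra.
apply: mulr_ge0; first by rewrite mulr_ge0// ltW.
by rewrite mulr_ge0// invr_ge0 sqr_ge0.
Qed.

Section Mixture.
Variable gamma : R.
Hypothesis (gamma_gt0 : 0 < gamma) (gamma_le1 : gamma <= 1).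

Let subr_gamma_ge0 : 0 <= 1 - gamma. Proof. by rewrite subr_ge0. Qed.

(** The law for which [phit] plays the role of [phi]. *)
Definition mixture : {measure set (measurableTypeR R) -> \bar R} :=
  measure_add (mscale (NngNum (ltW gamma_gt0)) mu)
    (mscale (NngNum subr_gamma_ge0) (dirac (0 : measurableTypeR R))).

Lemma mixtureE A :
  mixture A = (gamma%:E * mu A +
    (1 - gamma)%:E * dirac (0%R : measurableTypeR R) A)%E.
Proof. exact: measure_addE. Qed.

Lemma mixture_lty : (mixture setT < +oo)%E.
Proof.
rewrite mixtureE diracT mule1.
by rewrite [X in (_ * X)%E]probability_setT mule1 -EFinD ltry.
Qed.

Lemma mixture_clip_sqr_neq0 : (0 < mixture [set z | (clip_sqr z != 0)%R])%E.
Proof.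
rewrite mixtureE.
apply: (@lt_le_trans _ _ (gamma%:E * mu [set z | (clip_sqr z != 0)%R])%E).
  by rewrite mule_gt0 ?lte_fin// clip_sqr_neq0.
by rewrite leeDl// mule_ge0// lee_fin.
Qed.

(** The unit mass at 0 contributes [y / (y ^+ 2 - 0) = 1 / y]. *)
Lemma phitE y : zplus H < y ->
  phit gamma H y = y * resolvent_moment mixture clip_sqr 1 (y ^+ 2).
Proof.
move=> zy; have cy := sqr_zplus_lt zy.
have y_gt0 := lt_trans zplus_gt0 zy.
rewrite /phit phiE// /resolvent_moment /Rintegral.
have p_ge0 x : setT x -> (0 <= ((y ^+ 2 - clip_sqr x)^-1 ^+ 1)%:E)%E.
  move=> _; rewrite lee_fin expr1 invr_ge0 subr_ge0.
  by rewrite (le_trans (clip_sqr_le x))// ltW.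
have ip := resolvent_moment_integrable
  dH_lty measurable_clip_sqr clip_sqr_le 1 cy.
have mp : measurable_fun setT (fun x => ((y ^+ 2 - clip_sqr x)^-1 ^+ 1)%:E).
  exact: measurable_int ip.
rewrite ge0_integral_measure_add// !ge0_integral_mscale//=.
rewrite integral_dirac// diracT mul1e.
have := integrable_fin_num measurableT ip.
move: (integral _ _ _) => I If; rewrite -(fineK If) /=.
rewrite /clip_sqr clip_id ?oppr_le0 ?(ltW zplus_gt0)// expr0n subr0 expr1.
by field; rewrite gt_eqF.
Qed.

(** * The logarithmic derivative *)

Local Notation A1 := (resolvent_moment mu clip_sqr).
Local Notation A2 := (resolvent_moment mixture clip_sqr).
Local Notation L1 := (elasticity mu clip_sqr).
Local Notation L2 := (elasticity mixture clip_sqr).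
Local Notation D := (calD gamma H).

Let mc := measurable_clip_sqr.
Let cge0 : 0 <= zplus H ^+ 2 := sqr_ge0 _.

Let A1_gt0 k y (zy : zplus H < y) : 0 < A1 k (y ^+ 2) :=
  resolvent_moment_gt0 dH_lty mc clip_sqr_le clip_sqr_neq0 k
    (sqr_zplus_lt zy).
Let A2_gt0 k y (zy : zplus H < y) : 0 < A2 k (y ^+ 2) :=
  resolvent_moment_gt0 mixture_lty mc clip_sqr_le mixture_clip_sqr_neq0 k
    (sqr_zplus_lt zy).

Lemma calDE y : zplus H < y -> D y = y ^+ 2 * A1 1 (y ^+ 2) * A2 1 (y ^+ 2).
Proof. by move=> zy; rewrite /calD phiE// phitE//; ring. Qed.

Lemma calD_gt0 y : zplus H < y -> 0 < D y.
Proof.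
move=> zy; rewrite calDE// mulr_gt0 ?A2_gt0// mulr_gt0 ?A1_gt0//.
by rewrite exprn_gt0// (lt_trans zplus_gt0).
Qed.

Lemma is_derive_calD y : zplus H < y ->
  is_derive y 1 D (D y / y * (2 - 2 * L1 (y ^+ 2) - 2 * L2 (y ^+ 2))).
Proof.
move=> zy; have cy := sqr_zplus_lt zy.
have y_gt0 := lt_trans zplus_gt0 zy.
have hsq : is_derive y 1 (fun y : R => y ^+ 2) (2 * y).
  rewrite [X in is_derive _ _ _ X](_ : _ = (2%:R * y ^+ 1) *: 1).
    by have := is_deriveX 2 (is_derive_id y 1); rewrite exprfctE.
  by rewrite /GRing.scale/= mulr1 expr1.
have h1 := @is_derive1_comp _ _ (fun y : R => y ^+ 2) _ _ _
  (is_derive_resolvent_moment dH_lty mc clip_sqr_le 1 cy) hsq.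
have h2 := @is_derive1_comp _ _ (fun y : R => y ^+ 2) _ _ _
  (is_derive_resolvent_moment mixture_lty mc clip_sqr_le 1 cy) hsq.
have h := is_deriveM (is_deriveM hsq h1) h2.
apply: (@near_eq_is_derive _ R^o R^o
  (fun y => y ^+ 2 * A1 1 (y ^+ 2) * A2 1 (y ^+ 2))).
  near=> t; rewrite calDE//; near: t; exact: lt_nbhsr.
rewrite [X in is_derive _ _ _ X](_ : _ =
  (y ^+ 2 * A1 1 (y ^+ 2)) * (- (1%:R * A2 2 (y ^+ 2)) * (2 * y)) +
  A2 1 (y ^+ 2) * (y ^+ 2 * (- (1%:R * A1 2 (y ^+ 2)) * (2 * y)) +
  A1 1 (y ^+ 2) * (2 * y))); first exact: h.
rewrite calDE// /elasticity.
have := gt_eqF (A1_gt0 1 zy); have := gt_eqF (A2_gt0 1 zy).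
by move=> a1 a2; field; rewrite a1 a2 gt_eqF.
Unshelve. all: by end_near. Qed.

Lemma derive_calD y : zplus H < y ->
  derive1 D y = D y / y * (2 - 2 * L1 (y ^+ 2) - 2 * L2 (y ^+ 2)).
Proof.
by move=> zy; rewrite derive1E; have [_ ->] := is_derive_calD zy.
Qed.

Lemma PsiE y : zplus H < y ->
  Psi gamma H y = 2 - 2 * L1 (y ^+ 2) - 2 * L2 (y ^+ 2).
Proof.
move=> zy; rewrite /Psi derive_calD//.
have D0 := gt_eqF (calD_gt0 zy).
by field; rewrite D0 gt_eqF// (lt_trans zplus_gt0).
Qed.

Lemma Psi_le_phi y : zplus H < y -> Psi gamma H y <= - 2 * L1 (y ^+ 2).
Proof.
move=> zy; have cy := sqr_zplus_lt zy; rewrite PsiE//.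
have := elasticity_ge1 mixture_lty mc clip_sqr_ge0 clip_sqr_le
  mixture_clip_sqr_neq0 cy.
by lra.
Qed.

Lemma Psi_le y : zplus H < y -> Psi gamma H y <= - 2.
Proof.
move=> zy; have cy := sqr_zplus_lt zy; apply: le_trans (Psi_le_phi zy) _.
have := elasticity_ge1 dH_lty mc clip_sqr_ge0 clip_sqr_le clip_sqr_neq0 cy.
by lra.
Qed.

Lemma Psi_increasing y1 y2 : zplus H < y1 -> y1 < y2 ->
  Psi gamma H y1 < Psi gamma H y2.
Proof.
move=> zy1 y12; have zy2 := lt_trans zy1 y12; rewrite !PsiE//.
have cy := sqr_zplus_lt zy1.
have s12 : y1 ^+ 2 < y2 ^+ 2.
  by rewrite ltr_pXn2r ?nnegrE// ltW// (lt_trans zplus_gt0).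
have := elasticity_decreasing dH_lty mc clip_sqr_ge0 clip_sqr_le cge0
  clip_sqr_neq0 cy s12.
have := elasticity_decreasing mixture_lty mc clip_sqr_ge0 clip_sqr_le cge0
  mixture_clip_sqr_neq0 cy s12.
by lra.
Qed.

Lemma Psi_cvg : Psi gamma H @ +oo --> (-2 : R).
Proof.
have sqy : (fun y : R => y ^+ 2) y @[y --> +oo] --> +oo.
  apply/cvgryPge => M; near=> y.
  have y1 : 1 <= y by near: y; apply: nbhs_pinfty_ge; rewrite num_real.
  have yM : M <= y by near: y; apply: nbhs_pinfty_ge; rewrite num_real.
  by rewrite expr2; nra.
have e1 := elasticity_cvg dH_lty mc clip_sqr_ge0 clip_sqr_le cge0 clip_sqr_neq0.
have e2 := elasticity_cvg mixture_lty mc clip_sqr_ge0 clip_sqr_le cge0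
  mixture_clip_sqr_neq0.
have h : (fun y => 2 - 2 * L1 (y ^+ 2) - 2 * L2 (y ^+ 2)) y @[y --> +oo] -->
    (2 - 2 * 1 - 2 * 1 : R).
  apply: cvgB; [apply: cvgB; first exact: cvg_cst|];
    apply: cvgM; try exact: cvg_cst.
  - exact: (cvg_comp _ _ sqy e1).
  - exact: (cvg_comp _ _ sqy e2).
rewrite (_ : (-2 : R) = 2 - 2 * 1 - 2 * 1); last by ring.
apply: cvg_trans h; apply: near_eq_cvg; near=> y; rewrite PsiE//.
by near: y; apply: nbhs_pinfty_gt; rewrite num_real.
Unshelve. all: by end_near. Qed.

Lemma Psi_continuous y : zplus H < y -> {for y, continuous (Psi gamma H)}.
Proof.
move=> zy; have cy := sqr_zplus_lt zy.
have c1 := elasticity_continuous dH_lty mc clip_sqr_le clip_sqr_neq0 cy.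
have c2 := elasticity_continuous mixture_lty mc clip_sqr_le
  mixture_clip_sqr_neq0 cy.
have sqc : (fun y : R => y ^+ 2) @ y --> y ^+ 2 by exact: exprn_continuous.
rewrite /prop_for /continuous_at PsiE//.
have h : (fun y => 2 - 2 * L1 (y ^+ 2) - 2 * L2 (y ^+ 2)) t @[t --> y] -->
    (2 - 2 * L1 (y ^+ 2) - 2 * L2 (y ^+ 2)).
  apply: cvgB; [apply: cvgB; first exact: cvg_cst|];
    apply: cvgM; try exact: cvg_cst.
  - exact: (cvg_comp _ _ sqc c1).
  - exact: (cvg_comp _ _ sqc c2).
apply: cvg_trans h; apply: near_eq_cvg; near=> t; rewrite PsiE//.
by near: t; exact: lt_nbhsr.
Unshelve. all: by end_near. Qed.

(** The blow-up drives the elasticity of [dH] above 3, hence [Psi] below -6. *)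
Lemma Psi_edge : edge_blowup H ->
  exists2 y, zplus H < y & Psi gamma H y < -4.
Proof.
move=> /cvgryPge edge.
near (zplus H)^'+ => y.
have zy : zplus H < y by near: y; exact: nbhs_right_gt.
exists y => //; apply: le_lt_trans (Psi_le_phi zy) _.
have cy := sqr_zplus_lt zy.
suff : 3 <= L1 (y ^+ 2) by lra.
apply: (elasticity_ge dH_lty mc clip_sqr_le cge0 clip_sqr_neq0) => //.
  exact: probability_setT.
have E1 := edge_le zy.
(* With [s = y ^+ 2 >= zplus H ^+ 2], 36 is [4 * 3 ^+ 2]: the factor 4 comes
   from [edge_le], and [s ^+ 2 * A1 2 s >= 3 ^+ 2] is the target. *)
have E2 : 36 / zplus H ^+ 2 <= \int[mu]_z ((y - z) ^- 2).
  by near: y; exact: edge.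
have c_gt0 : 0 < zplus H ^+ 2 by rewrite exprn_gt0.
have := le_trans E2 E1; rewrite ler_pdivrMr//.
have := A1_gt0 2 zy; move: (A1 2 (y ^+ 2)) => B B_gt0 h.
rewrite (expr2 (y ^+ 2)) -mulrA.
have := mulr_ge0 (ltW B_gt0) (ltW (le_lt_trans cge0 cy)) => yB.
by nra.
Unshelve. all: by end_near. Qed.

Lemma Tgamma_root : edge_blowup H ->
  zplus H < Tgamma gamma H /\ Psi gamma H (Tgamma gamma H) = -4.
Proof.
move=> edge; have [y0 zy0 Py0] := Psi_edge edge.
have [y1 y01 Py1] : exists2 y1, y0 < y1 & -4 < Psi gamma H y1.
  near (pinfty_nbhs R) => y; exists y.
    by near: y; apply: nbhs_pinfty_gt; rewrite num_real.
  near: y; apply: (cvgr_gt _ Psi_cvg); lra.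
have [t] : exists2 t, t \in `[y0, y1] & Psi gamma H t = -4.
  apply: IVT; first exact: ltW.
    apply: continuous_in_subspaceT => y; rewrite inE/= in_itv/= => /andP[yy0 _].
    by apply: Psi_continuous; exact: lt_le_trans yy0.
  by rewrite ge_min le_max (ltW Py0) (ltW Py1) orbT.
rewrite in_itv/= => /andP[t0 _] Pt; have zt := lt_le_trans zy0 t0.
suff -> : Tgamma gamma H = t by [].
rewrite /Tgamma.
have -> : [set y | zplus H < y /\ -4 <= Psi gamma H y] = `[t, +oo[%classic.
  apply/seteqP; split => y /=; rewrite in_itv/= andbT.
    move=> [zy Py]; rewrite leNgt; apply/negP => yt.
    by have := Psi_increasing zy yt; rewrite Pt ltNge Py.
  rewrite le_eqVlt => /predU1P[<-|ty]; first by rewrite Pt.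
  split; first exact: lt_trans ty.
  by have := Psi_increasing zt ty; rewrite Pt => /ltW.
by rewrite inf_itv// bnd_simp.
Unshelve. all: by end_near. Qed.

(** * Signal strengths *)

Local Notation T := (Tgamma gamma H).

Let itvP y : (y \in `]zplus H, +oo[%classic) = (zplus H < y).
Proof. by apply/idP/idP; rewrite inE/= in_itv/= andbT. Qed.

Lemma calD_continuous y : zplus H < y -> {for y, continuous D}.
Proof.
move=> zy; have [dD _] := is_derive_calD zy.
by apply: differentiable_continuous; apply/derivable1_diffP.
Qed.

Lemma calD_decreasing y1 y2 : zplus H < y1 -> y1 < y2 -> D y2 < D y1.
Proof.
move=> zy1 y12.
have zy y : y1 <= y -> zplus H < y by exact: lt_le_trans.
have [||t ty] := @MVT _ D (derive1 D) y1 y2 y12.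
- move=> t; rewrite in_itv/= => /andP[/ltW /zy zt _].
  by rewrite derive_calD//; exact: is_derive_calD.
- apply: continuous_in_subspaceT => t.
  rewrite inE/= in_itv/= => /andP[/zy zt _].
  exact: calD_continuous.
move: ty; rewrite in_itv/= => /andP[/ltW /zy zt _] E.
rewrite -subr_lt0 E pmulr_llt0 ?subr_gt0// derive_calD// -PsiE//.
have t_gt0 := lt_trans zplus_gt0 zt.
rewrite pmulr_rlt0 ?divr_gt0 ?calD_gt0//.
by have := Psi_le zt; lra.
Qed.

(** The first moments are at most [mass / (s - c)], and [s - c >= s / 2] far
    away, so [calD y] is at most [4 * m1 * m2 / y ^+ 2]. *)
Lemma calD_small e : 0 < e -> exists2 y, zplus H < y & D y < e.
Proof.
move=> e_gt0; pose c := zplus H ^+ 2.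
pose m1 := fine (mu setT); pose m2 := fine (mixture setT).
near (pinfty_nbhs R) => y; exists y.
  by near: y; apply: nbhs_pinfty_gt; rewrite num_real.
have zy : zplus H < y by near: y; apply: nbhs_pinfty_gt; rewrite num_real.
have y1 : 1 <= y by near: y; apply: nbhs_pinfty_ge; rewrite num_real.
have yc : 2 * c <= y by near: y; apply: nbhs_pinfty_ge; rewrite num_real.
have ye : 4 * m1 * m2 / e < y.
  by near: y; apply: nbhs_pinfty_gt; rewrite num_real.
have ys : y <= y ^+ 2 by rewrite expr2; nra.
have cy := sqr_zplus_lt zy; have s_gt0 := le_lt_trans cge0 cy.
have B1 := resolvent_moment1_le dH_lty mc clip_sqr_le cy.
have B2 := resolvent_moment1_le mixture_lty mc clip_sqr_le cy.
rewrite calDE//; move: (A1_gt0 1 zy) (A2_gt0 1 zy) B1 B2.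
rewrite -/c -/m1 -/m2 !ler_pdivlMr ?subr_gt0//.
move: (A1 1 (y ^+ 2)) (A2 1 (y ^+ 2)) => a1 a2 a1_gt0 a2_gt0 B1 B2.
rewrite -(ltr_pM2l s_gt0).
have B1' : a1 * y ^+ 2 <= 2 * m1 by nra.
have B2' : a2 * y ^+ 2 <= 2 * m2 by nra.
have : (a1 * y ^+ 2) * (a2 * y ^+ 2) <= (2 * m1) * (2 * m2).
  by apply: ler_pM => //; rewrite mulr_ge0// ltW.
move: ye; rewrite ltr_pdivrMr//.
have : y * e <= y ^+ 2 * e by rewrite ler_pM2r.
by lra.
Unshelve. all: by end_near. Qed.

Lemma calD_powE y : zplus H < y -> D y `^ (- 2^-1) = (Num.sqrt (D y))^-1.
Proof. by move=> zy; rewrite powRN powR12_sqrt// ltW// calD_gt0. Qed.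

(** The signal strength [x] with [calY x = y], see [calY_signal_at] and
    [above_xplus]; its limit at the edge is [xplus]. *)
Definition signal_at y := D y `^ (- 2^-1).

Local Notation g := signal_at.

Let g_gt0 y : zplus H < y -> 0 < g y.
Proof.
by move=> zy; rewrite /signal_at calD_powE// invr_gt0 sqrtr_gt0 calD_gt0.
Qed.

Let g_sqr y : zplus H < y -> 1 / g y ^+ 2 = D y.
Proof.
move=> zy; rewrite /signal_at calD_powE// exprVn invrK mul1r sqr_sqrtr//.
by rewrite ltW// calD_gt0.
Qed.

Let g_incr y1 y2 : zplus H < y1 -> y1 < y2 -> g y1 < g y2.
Proof.
move=> zy1 y12; have zy2 := lt_trans zy1 y12.
rewrite /signal_at !calD_powE// ltf_pV2 ?posrE ?sqrtr_gt0 ?calD_gt0//.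
by rewrite ltr_sqrt ?calD_gt0// calD_decreasing.
Qed.

Lemma xplusE : xplus gamma H = inf [set g y | y in `]zplus H, +oo[].
Proof.
apply/cvg_lim => //.
apply: (@nondecreasing_at_right_cvgr R g (zplus H) (BInfty R false)) => //.
- move=> y1 y2; rewrite !in_itv/= !andbT => z1 _.
  by rewrite le_eqVlt => /predU1P[->//|/(g_incr z1)/ltW].
- exists 0 => _ [y + <-]; rewrite /= in_itv/= andbT => /g_gt0.
  exact: ltW.
Qed.

Lemma xplus_lt_signal_at y : zplus H < y -> xplus gamma H < g y.
Proof.
move=> zy; set m := (zplus H + y) / 2.
have zm' : zplus H < m by case: (midf_lt zy).
have my' : m < y by case: (midf_lt zy).
apply: le_lt_trans (g_incr zm' my'); rewrite xplusE; apply: ge_inf.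
  exists 0 => _ [t + <-]; rewrite /= in_itv/= andbT => /g_gt0.
  exact: ltW.
by exists m => //=; rewrite in_itv/= zm'.
Qed.

Lemma calY_signal_at y : zplus H < y -> calY gamma H (g y) = y.
Proof.
move=> zy; rewrite /calY g_sqr// pinvKV ?itvP//.
move=> y1 y2; rewrite !itvP => z1 z2 E.
by case: (ltgtP y1 y2) => // [/(calD_decreasing z1)|/(calD_decreasing z2)];
  rewrite E ltxx.
Qed.

Lemma above_xplus x : 0 < x -> xplus gamma H < x ->
  exists2 y, zplus H < y & x = g y.
Proof.
move=> x_gt0; rewrite xplusE => /inf_lt[].
  exists (g (zplus H + 1)), (zplus H + 1) => //=.
  by rewrite in_itv/= ltrDl ltr01.
move=> _ [y0 + <-]; rewrite /= in_itv/= andbT => zy0 g0x.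
have D0 : 1 / x ^+ 2 < D y0.
  rewrite -g_sqr// !div1r ltf_pV2 ?posrE ?exprn_gt0 ?g_gt0//.
  by rewrite ltr_pXn2r ?nnegrE ?(ltW x_gt0)// ltW// g_gt0.
have [y1 zy1 D1] : exists2 y, zplus H < y & D y < 1 / x ^+ 2.
  by apply: calD_small; rewrite divr_gt0// exprn_gt0.
have y01 : y0 < y1.
  rewrite ltNge; apply/negP.
  rewrite le_eqVlt => /predU1P[E|/(calD_decreasing zy1)].
    by move: D0; rewrite -E ltNge (ltW D1).
  by move=> D10; have := lt_trans D0 (lt_trans D10 D1); rewrite ltxx.
have [y] : exists2 y, y \in `[y0, y1] & D y = 1 / x ^+ 2.
  apply: IVT; first exact: ltW.
    apply: continuous_in_subspaceT => y; rewrite inE/= in_itv/= => /andP[yy0 _].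
    by apply: calD_continuous; exact: lt_le_trans yy0.
  by rewrite ge_min le_max (ltW D0) (ltW D1) orbT.
rewrite in_itv/= => /andP[y0y _] Dy; have zy := lt_le_trans zy0 y0y.
exists y => //; rewrite /signal_at calD_powE// Dy div1r sqrtrV ?sqr_ge0//.
by rewrite invrK sqrtr_sqr gtr0_norm.
Qed.

(** * Risks and thresholds *)

(** Here [calD y = 1 / x ^+ 2] turns [2 * x * y * calC x] into
    [- 4 * y ^+ 2 / Psi y]. *)
Lemma R1_sub_R0 y : zplus H < y ->
  R1 gamma H (g y) - R0 (g y) = (Psi gamma H y + 4) * (y ^+ 2 / Psi gamma H y).
Proof.
move=> zy; have y_gt0 := lt_trans zplus_gt0 zy.
have gy := g_gt0 zy.
rewrite /R1 xplus_lt_signal_at// /R0 /calC calY_signal_at// derive_calD//.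
rewrite -PsiE// -g_sqr//.
have P0 : Psi gamma H y != 0 by rewrite lt_eqF//; have := Psi_le zy; lra.
by field; rewrite P0 !gt_eqF.
Qed.

Let sqr_div_Psi_lt0 y : zplus H < y -> y ^+ 2 / Psi gamma H y < 0.
Proof.
move=> zy; rewrite pmulr_rlt0 ?exprn_gt0 ?(lt_trans zplus_gt0 zy)//.
by rewrite invr_lt0; have := Psi_le zy; lra.
Qed.

Lemma R0_le_R1 y : zplus H < y ->
  (R0 (g y) <= R1 gamma H (g y)) = (Psi gamma H y <= -4).
Proof.
move=> zy; rewrite -subr_ge0 R1_sub_R0// nmulr_lge0 ?sqr_div_Psi_lt0//.
by rewrite -lerBrDr sub0r.
Qed.

Lemma R1_le_R0 y : zplus H < y ->
  (R1 gamma H (g y) <= R0 (g y)) = (-4 <= Psi gamma H y).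
Proof.
move=> zy; rewrite -subr_le0 R1_sub_R0// nmulr_lle0 ?sqr_div_Psi_lt0//.
by rewrite -lerBlDr sub0r.
Qed.

Definition ase_term x theta : R :=
  (yinf gamma H x <= theta)%R%:R * R0 x +
  (theta < yinf gamma H x)%R%:R * R1 gamma H x.

Lemma ase_termE x theta :
  ase_term x theta = if yinf gamma H x <= theta then R0 x else R1 gamma H x.
Proof.
by rewrite /ase_term; case: leP => _; rewrite !(mul1r, mul0r, addr0, add0r).
Qed.

Lemma ase_term_ge_min x theta :
  Num.min (R0 x) (R1 gamma H x) <= ase_term x theta.
Proof. by rewrite ase_termE; case: ifP => _; rewrite ge_min lexx ?orbT. Qed.

Lemma ASE_ge r (x : 'rV[R]_r) theta : ASEstar gamma H x <= ASE gamma H x theta.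
Proof. by apply: ler_sum => i _; exact: ase_term_ge_min. Qed.

Lemma yinf_signal_at y : zplus H < y -> yinf gamma H (g y) = y.
Proof. by move=> zy; rewrite /yinf xplus_lt_signal_at// calY_signal_at. Qed.

(** At or below the edge ([x <= xplus]), the threshold [T > zplus] keeps [R0],
    which is smaller than [R1 = R0 + zplus ^+ 2]. *)
Lemma Tgamma_optimal x : edge_blowup H -> 0 < x ->
  ase_term x T = Num.min (R0 x) (R1 gamma H x).
Proof.
move=> edge x_gt0; have [zT PT] := Tgamma_root edge; rewrite ase_termE.
have [xx|xx] := ltP (xplus gamma H) x; last first.
  rewrite /yinf /R1 ltNge xx /= (ltW zT) min_l// /R0 lerDl.
  exact: sqr_ge0.
have [y zy xE] := above_xplus x_gt0 xx; rewrite xE yinf_signal_at//.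
case: leP => [|Ty].
  rewrite le_eqVlt => yT; rewrite min_l// R0_le_R1//.
  by move: yT => /predU1P[->|/(Psi_increasing zy)]; rewrite PT// => /ltW.
by rewrite min_r// R1_le_R0// -PT ltW// Psi_increasing.
Qed.

Lemma ase_term_suboptimal y theta : edge_blowup H -> zplus H < y ->
  theta < y < T \/ T < y <= theta ->
  Num.min (R0 (g y)) (R1 gamma H (g y)) < ase_term (g y) theta.
Proof.
move=> edge zy; have [zT PT] := Tgamma_root edge.
rewrite ase_termE yinf_signal_at//.
move=> [/andP[ty yT]|/andP[Ty yt]].
  rewrite leNgt ty /= gt_min ltNge R1_le_R0// -ltNge -PT.
  by rewrite Psi_increasing.
rewrite yt gt_min [X in _ || X]ltNge R0_le_R1// -ltNge -PT.
by rewrite Psi_increasing ?orbT.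
Qed.

Lemma Tgamma_optimal_threshold r (x : 'rV[R]_r) : edge_blowup H ->
  signal x -> optimal_threshold gamma H x T.
Proof.
move=> edge [_ x_gt0]; have [zT _] := Tgamma_root edge.
have E : ASE gamma H x T = ASEstar gamma H x.
  by apply: eq_bigr => i _; exact: Tgamma_optimal.
split => //; split.
  by exists T => //=; rewrite in_itv/= andbT (lt_trans zplus_gt0).
by move=> _ [t _ <-]; rewrite E ASE_ge.
Qed.

Lemma optimal_threshold_unique r theta : edge_blowup H -> (0 < r)%N ->
  (forall x : 'rV[R]_r, signal x -> optimal_threshold gamma H x theta) ->
  theta = T.
Proof.
move=> edge r_gt0 opt; have [zT PT] := Tgamma_root edge.
apply/eqP; apply/negPn/negP => thetaT.
(* An interval of values of [y] on which the choice made at [theta] is wrong. *)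
have [a [b [za ab sep]]] : exists a b, [/\ zplus H <= a, a < b &
    forall y, a < y <= b -> theta < y < T \/ T < y <= theta].
  move: thetaT; rewrite neq_lt => /orP[tT|Tt].
    pose a := Num.max (zplus H) theta.
    have aT : a < T by rewrite /a gt_max zT.
    have [am mb] := midf_lt aT.
    exists a, ((a + T) / 2); split => //; first by rewrite /a le_max lexx.
    move=> y /andP[ay yb]; left.
    rewrite (le_lt_trans yb)// andbT (le_lt_trans _ ay)//.
    by rewrite /a le_max lexx orbT.
  by exists T, theta; split => //; [exact: ltW|move=> y yy; right].
(* Any decreasing family in that interval yields a signal. *)
pose y (i : 'I_r) := a + (b - a) / i.+1%:R.
have aby i : a < y i <= b.
  rewrite /y ltrDl divr_gt0 ?subr_gt0//= -lerBrDl ler_pdivrMr//.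
  by rewrite ler_peMr ?subr_ge0 ?(ltW ab)// ler1n.
have zy i : zplus H < y i by have /andP[+ _] := aby i; exact: le_lt_trans.
pose x : 'rV[R]_r := \row_i g (y i).
have sx : signal x.
  split => [i j ij|i]; rewrite !mxE ?g_gt0//.
  apply: g_incr => //; rewrite /y ltrD2l ltr_pM2l ?subr_gt0//.
  by rewrite ltf_pV2 ?posrE// ltr_nat.
have [_ E] := opt x sx.
suff : ASEstar gamma H x < ASE gamma H x theta by rewrite E ltxx.
apply: ltr_sum => [|i _].
  by apply/hasP; exists (Ordinal r_gt0); rewrite ?mem_index_enum.
by rewrite mxE; apply: ase_term_suboptimal => //; exact: sep.
Qed.

End Mixture.
End Spectrum.

Theorem lemma1 (R : realType) (gamma : R) (gamma_gt0 : 0 < gamma)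
    (gamma_le1 : gamma <= 1) :
  [/\ (forall H : cumulativeBounded (0 : R) (1 : R),
        compactly_supported_on_nonneg H -> 0 < zplus H ->
        [/\ (forall y : R, zplus H < y -> Psi gamma H y < 0),
            (forall y1 y2 : R, zplus H < y1 -> y1 < y2 ->
               Psi gamma H y1 < Psi gamma H y2) &
            Psi gamma H @ +oo --> (-2 : R)]),
      (forall H : cumulativeBounded (0 : R) (1 : R),
        compactly_supported_on_nonneg H -> 0 < zplus H -> edge_blowup H ->
        [/\ zplus H < Tgamma gamma H,
            Psi gamma H (Tgamma gamma H) = -4 &
            (forall y : R, zplus H < y -> Psi gamma H y = -4 ->
               y = Tgamma gamma H)]) &
      (forall FZ : cumulativeBounded (0 : R) (1 : R),
        compactly_supported_on_nonneg FZ -> 0 < zplus FZ -> edge_blowup FZ ->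
        forall r : nat, (1 <= r)%N ->
        [/\ 0 < Tgamma gamma FZ,
            (forall x : 'rV[R]_r, signal x ->
               optimal_threshold gamma FZ x (Tgamma gamma FZ)) &
            (forall theta : R, 0 < theta ->
               (forall x : 'rV[R]_r, signal x ->
                  optimal_threshold gamma FZ x theta) ->
               theta = Tgamma gamma FZ)])].
Proof.
split.
- move=> H suppH z0; split.
  + by move=> y /(Psi_le suppH z0 gamma_gt0 gamma_le1); lra.
  + by move=> y1 y2; exact: Psi_increasing.
  + exact: Psi_cvg.
- move=> H suppH z0 edge.
  have [zT PT] := Tgamma_root suppH z0 gamma_gt0 gamma_le1 edge.
  split => // y zy Py.
  have incr := Psi_increasing suppH z0 gamma_gt0 gamma_le1.
  by case: (ltgtP y (Tgamma gamma H)) => // [/(incr _ _ zy)|/(incr _ _ zT)];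
    rewrite Py PT ltxx.
- move=> FZ suppFZ z0 edge r r_ge1.
  have [zT _] := Tgamma_root suppFZ z0 gamma_gt0 gamma_le1 edge.
  split; first exact: lt_trans zT.
  + by move=> x; exact: Tgamma_optimal_threshold.
  + by move=> theta _; exact: optimal_threshold_unique.
Qed.
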